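(* For the path $I_p$ and the cycle $C_p$ on $p$ nodes we have that $$M(I_p;x)=F_{p-1}(x)\qquad\text{and}\qquad M(C_p;x)=L_p(x)-1.$$ In particular, the number of Markov equivalence classes with skeleton $I_p$ and $C_p$, respectively, is $$M(I_p)=F_{p-1}\qquad\text{and}\qquad M(C_p)=L_p-1,$$ and the maximum number of immoralities is $$m(I_{p+2})=m(C_p)=\left\lfloor\frac p2\right\rfloor.$$
   Context: A DAG with skeleton $G$ (a finite simple undirected graph) is an acyclic orientation of all edges of $G$. An immorality in a DAG is an induced subgraph $i\to j\leftarrow k$ (so $i,k$ are nonadjacent). Two DAGs are Markov equivalent iff they have the same skeleton and the same set of immoralities; a Markov equivalence class (MEC) with skeleton $G$ is an equivalence class of DAGs with skeleton $G$, and all its members have the same immoralities. Let $m_k(G)$ be the number of MECs with skeleton $G$ having exactly $k$ immoralities, $M(G;x)=\sum_{k\ge0}m_k(G)x^k$, $M(G)=M(G;1)$ the total number of MECs with skeleton $G$, and $m(G)=\deg M(G;x)$ the maximum number of immoralities in an MEC with skeleton $G$. $I_p$ is the path with $p$ vertices and $C_p$ is the cycle with $p$ vertices. Fibonacci numbers: $F_0=F_1=1$, $F_p=F_{p-1}+F_{p-2}$ for $p\ge2$. Fibonacci polynomials: $F_p(x)=\sum_{k=0}^{\lfloor p/2\rfloor}\binom{p-k}{k}x^k$. Lucas numbers: $L_0=2$, $L_1=1$, $L_p=L_{p-1}+L_{p-2}$ for $p\ge2$. Lucas polynomials: $L_0(x)=2$, $L_1(x)=1$, $L_p(x)=L_{p-1}(x)+xL_{p-2}(x)$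 for $p\ge2$.
   Formalization: The printed $m(I_{p+2})=\lfloor p/2\rfloor$ fails for odd $p$ (e.g. $m(I_3)=1$) and is corrected to $m(I_{p+1})=\lfloor p/2\rfloor$; the claims for $C_p$ are stated for $p\ge4$, since $C_3$ has no immoralities, so $M(C_3;x)=1\ne 3x=L_3(x)-1$. *)

(* Defs.v *)
From mathcomp Require Import all_boot all_order all_algebra.

Set Implicit Arguments.
Unset Strict Implicit.
Unset Printing Implicit Defensive.

Import GRing.Theory Num.Theory.
Local Open Scope ring_scope.

(* A directed graph on T is its set of arcs D : {set T * T}, where (i, j)
   stands for i -> j.  A simple undirected graph G is a symmetric irreflexive
   adjacency relation e : rel T. *)
Section DAGs.
Variable T : finType.
Implicit Types (e : rel T) (D : {set T * T}).

Definition arc D : rel T := fun i j => (i, j) \in D.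

Definition skeleton D : rel T := fun i j => arc D i j || arc D j i.

Definition acyclic D : bool :=
  [forall i, forall j, arc D i j ==> ~~ connect (arc D) j i].

Lemma acyclicP D :
  reflect (forall s : seq T, s <> [::] -> ~~ cycle (arc D) s) (acyclic D).
Proof.
apply: (iffP 'forall_'forall_implyP) => [acD [|x p] //= _|noC i j ij].
  apply/negP; rewrite rcons_path => /andP[px lx].
  by have /connectP[] := acD _ _ lx; exists p.
apply/connectP => -[p jp ip].
have /negP : ~~ cycle (arc D) (j :: p) by apply: noC.
by case; rewrite /= rcons_path jp -ip.
Qed.

Definition orientation e D : bool :=
  [forall i, forall j,
     (e i j == skeleton D i j) && ~~ (arc D i j && arc D j i)].

Definition dags e : {set {set T * T}} :=
  [set D | orientation e D && acyclic D].

(* The immorality i -> j <- k is encoded by the pair ({i, k}, j), so that it is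
   counted once and not once for each order of i and k. *)
Definition immoralities D : {set {set T} * T} :=
  [set q | [exists i, exists k,
     [&& q.1 == [set i; k], i != k, ~~ skeleton D i k,
         arc D i q.2 & arc D k q.2]]].

Definition markov_equiv D1 D2 : bool :=
  [forall i, forall j, skeleton D1 i j == skeleton D2 i j]
  && (immoralities D1 == immoralities D2).

Definition mecs e : {set {set {set T * T}}} :=
  equivalence_partition markov_equiv (dags e).

(* m_k(G); all members of a class have the same immoralities, and the classes
   are not empty. *)
Definition num_mecs_imm e (k : nat) : nat :=
  #|[set C in mecs e | [forall D in C, #|immoralities D| == k]]|.

(* No digraph has more than imm_bound immoralities: this is a valid cut-off for
   the sum over all k >= 0 that defines M(G; x). *)
Definition imm_bound : nat := #|{: {set T} * T}|.

Definition mec_poly e : {poly int} :=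
  \sum_(0 <= k < imm_bound.+1) (num_mecs_imm e k)%:R *: 'X^k.

Definition num_mecs e : nat := #|mecs e|.

Definition max_immoralities e : nat :=
  \max_(0 <= k < imm_bound.+1 | num_mecs_imm e k != 0%N) k.

Lemma markov_equiv_rel e : {in dags e & &, equivalence_rel markov_equiv}.
Proof.
move=> D1 D2 D3 _ _ _; split; rewrite /markov_equiv.
  by rewrite eqxx andbT; apply/'forall_'forall_eqP.
case/andP=> /'forall_'forall_eqP sk /eqP ->; congr (_ && _).
by apply: eq_forallb => i; apply: eq_forallb => j; rewrite sk.
Qed.

Lemma mec_immP e (C : {set {set T * T}}) : C \in mecs e ->
  exists2 n : nat, (n < imm_bound.+1)%N &
    forall k : nat, [forall D in C, #|immoralities D| == k] = (k == n).
Proof.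
move=> Ce; have /and3P[_ _ n0] :=
  equivalence_partitionP (@markov_equiv_rel e).
have [D0 D0C] : exists D, D \in C.
  by apply/set0Pn; apply: contraNneq n0 => <-.
exists #|immoralities D0|; first by rewrite ltnS max_card.
have sameI D : D \in C -> immoralities D = immoralities D0.
  case/imsetP: Ce => D1 _ eqC; move: D0C; rewrite eqC !inE.
  by do 2![case/and3P=> _ _ /eqP <-].
move=> k; apply/'forall_implyP/eqP => [/(_ _ D0C)/eqP // | -> D /sameI -> //].
Qed.

Lemma num_mecs_imm_ge e (k : nat) :
  (imm_bound < k)%N -> num_mecs_imm e k = 0%N.
Proof.
move=> ltk; apply/eqP; rewrite cards_eq0; apply/eqP/setP => C; rewrite !inE.
apply/negP => /andP[/mec_immP[n ltn ->] /eqP kn].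
by rewrite -kn ltnS leqNgt ltk in ltn.
Qed.

Lemma coef_mec_poly e (k : nat) : (mec_poly e)`_k = (num_mecs_imm e k)%:R.
Proof.
have -> : mec_poly e = \poly_(k < imm_bound.+1) (num_mecs_imm e k)%:R.
  by rewrite poly_def /mec_poly big_mkord.
by rewrite coef_poly; case: ltnP => // /num_mecs_imm_ge ->.
Qed.

Lemma horner1_mec_poly e : (mec_poly e).[1] = (num_mecs e)%:R.
Proof.
rewrite /mec_poly horner_sum (eq_bigr (fun k => (num_mecs_imm e k)%:R)).
  rewrite -natr_sum big_mkord; congr _%:R.
  pose P (k : 'I_imm_bound.+1) (C : {set {set T * T}}) : bool :=
    [forall D in C, #|immoralities D| == k].
  rewrite (eq_bigr (fun k => \sum_(C in mecs e) P k C)%N) => [|k _].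
    rewrite exchange_big /= /num_mecs -sum1_card; apply: eq_bigr => C.
    case/mec_immP => n ltn Pn.
    rewrite (bigD1 (Ordinal ltn)) //= [P _ C]Pn eqxx big1 // => k.
    by rewrite /P Pn -val_eqE /= => /negPf ->.
  rewrite /num_mecs_imm -sum1_card big_mkcond [RHS]big_mkcond /=; apply: eq_bigr => C _.
  by rewrite inE -/(P k C); case: (C \in _); case: (P k C).
by move=> k _; rewrite hornerZ hornerXn expr1n mulr1.
Qed.

Lemma deg_mec_poly e : (size (mec_poly e)).-1 = max_immoralities e.
Proof.
have nz k : (num_mecs_imm e k != 0)%N = ((mec_poly e)`_k != 0).
  by rewrite coef_mec_poly pnatr_eq0.
apply/eqP; rewrite eqn_leq; apply/andP; split.
  have [->|p0] := eqVneq (mec_poly e) 0; first by rewrite size_poly0.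
  have lc : num_mecs_imm e (size (mec_poly e)).-1 != 0%N.
    by rewrite nz -lead_coefE lead_coef_eq0.
  apply: (leq_bigmax_seq (F := id)) => //.
  rewrite mem_index_iota /= ltnS leqNgt.
  by apply: contraNN lc => /num_mecs_imm_ge ->.
apply/bigmax_leqP_seq => k _; rewrite nz => kn0; rewrite -ltnS.
have lk : (k < size (mec_poly e))%N.
  by rewrite ltnNge; apply: contraNN kn0 => /(nth_default 0) ->.
by rewrite prednK // (leq_trans _ lk).
Qed.

End DAGs.

Definition path_graph (p : nat) : rel 'I_p :=
  fun i j => (i.+1 == j :> nat) || (j.+1 == i :> nat).

(* ordS is the successor modulo p; this is the cycle C_p for p >= 3. *)
Definition cycle_graph (p : nat) : rel 'I_p :=
  fun i j => (ordS i == j) || (ordS j == i).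

(* Indexed so that F_0 = F_1 = 1. *)
Fixpoint fib (p : nat) : nat :=
  if p is p1.+1 then (if p1 is p2.+1 then fib p1 + fib p2 else 1)%N else 1%N.

Definition fib_poly (p : nat) : {poly int} :=
  \sum_(0 <= k < p./2.+1) 'C(p - k, k)%:R *: 'X^k.

Fixpoint lucas (p : nat) : nat :=
  if p is p1.+1 then (if p1 is p2.+1 then lucas p1 + lucas p2 else 1)%N
  else 2%N.

Fixpoint lucas_poly (p : nat) : {poly int} :=
  if p is p1.+1 then
    (if p1 is p2.+1 then lucas_poly p1 + 'X * lucas_poly p2 else 1)
  else 2%:R.

(* Main.v *)
From mathcomp Require Import all_boot all_order all_algebra.
From mathcomp Require Import zify ring.
Require Import Defs.

Import GRing.Theory Num.Theory.
Local Open Scope ring_scope.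
Set Implicit Arguments.
Unset Strict Implicit.
Unset Printing Implicit Defensive.

(** Since all DAGs on a fixed skeleton share that skeleton, a Markov equivalence
class is determined by its immoralities, and counting classes means counting
the sets of immoralities that DAGs realize ([mec_poly_immoralities]).

In a path or a cycle a vertex has at most two neighbours, so an immorality is
determined by its centre, a collider: a vertex with two neighbours, both of
which point to it. A class is thus a set S of colliders
([mec_poly_colliders]). Two adjacent vertices cannot both be colliders, as the
edge between them has only one direction; so S is stable. Conversely, list the
vertices in their order along the path or cycle, and orient the edge from i to
its successor forwards, unless i lies in S. When S is a stable set of vertices
with two neighbours, the colliders of this orientation are exactly S
([collider_orientationK]). The result is acyclic for a path; for a cycle it is
acyclic as soon as S is not empty ([collider_orientation_dag]), and a DAG whose
skeleton is a cycle does have a collider, namely any of its sinks ([dag_sink]).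

So M(I_p; x) counts the stable sets of inner vertices of the path by size, and
M(C_p; x) + 1 the stable sets of the cycle. Written as binary words without two
consecutive ones, they are counted by splitting off the first letter, which
gives the recurrence of the Fibonacci polynomials; opening the cycle at one
vertex gives L_p(x) = F_p(x) + x F_(p-2)(x). The numbers of classes are the
values at 1 and the maximal numbers of immoralities are the degrees. *)

(** * Counting classes by their immoralities *)

Section ClassesByImmoralities.
Variables (T : finType) (e : rel T).

Lemma mem_dagsP (D : {set T * T}) :
  reflect [/\ forall i j, e i j = arc D i j || arc D j i,
              forall i j, arc D i j -> ~~ arc D j i & acyclic D]
          (D \in dags e).
Proof.
rewrite inE; apply: (iffP andP) => [[/'forall_'forall_andP oD acD]|[eD asD acD]].
  split=> // i j; first by have [/eqP -> _] := oD i j.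
  by move=> ij; have [_] := oD i j; rewrite ij.
split=> //; apply/'forall_'forall_andP => i j; rewrite eD eqxx; split=> //.
by apply/negP => /andP[/asD /negP].
Qed.

Lemma mecs_fibers :
  mecs e = [set [set D in dags e | immoralities D == I]
             | I in @immoralities T @: dags e].
Proof.
rewrite -imset_comp; apply: eq_in_imset => D /mem_dagsP[eD _ _] /=.
apply/setP => D'; rewrite [LHS]in_set [RHS]in_set.
case: (boolP (D' \in dags e)) => [|_]; rewrite ?andbF //= => /mem_dagsP[eD' _ _].
rewrite /markov_equiv [in RHS]eq_sym andb_idl // => _.
by apply/'forall_'forall_eqP => i j; rewrite /skeleton -eD -eD'.
Qed.

Lemma num_mecs_imm_immoralities (k : nat) :
  num_mecs_imm e k = #|[set I in @immoralities T @: dags e | #|I| == k]|.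
Proof.
pose fiber I := [set D in dags e | immoralities D == I].
rewrite /num_mecs_imm mecs_fibers -/fiber.
have fiberE I D : D \in fiber I -> immoralities D = I.
  by rewrite !inE => /andP[_ /eqP].
have fiber_im I : I \in @immoralities T @: dags e -> exists D, D \in fiber I.
  by case/imsetP=> D De ->; exists D; rewrite /fiber in_set De /=.
rewrite -(card_in_imset (f := fiber)) => [|I J].
  apply: eq_card => C; rewrite !inE; apply/andP/imsetP => [[]|[I]].
    case/imsetP => I Ie -> /forall_inP allk; exists I => //; rewrite inE Ie.
    by have [D ID] := fiber_im _ Ie; rewrite -(fiberE _ _ ID) allk.
  rewrite inE => /andP[Ie /eqP <-] ->; split; first exact: imset_f.
  by apply/forall_inP => D /fiberE ->.
rewrite !inE => /andP[Ie _] _ IJ; have [D ID] := fiber_im _ Ie.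
by rewrite -(fiberE _ _ ID); apply: fiberE; rewrite -IJ.
Qed.

Lemma mec_poly_immoralities :
  mec_poly e = \sum_(I in @immoralities T @: dags e) 'X^#|I|.
Proof.
apply/polyP => k; rewrite coef_mec_poly num_mecs_imm_immoralities coef_sum.
rewrite -sum1_card natr_sum big_mkcond [RHS]big_mkcond /=.
apply: eq_bigr => I _; rewrite inE coefXn eq_sym.
by case: (I \in _); case: eqP.
Qed.

(** * Sinks and topological orders *)

(** A vertex that reaches as few vertices as possible is a sink: by acyclicity,
the head of an arc reaches fewer vertices than its tail. *)
Lemma dag_sink (x0 : T) D :
  D \in dags e -> exists j, forall i, e i j -> arc D i j.
Proof.
case/mem_dagsP=> eD _ /'forall_'forall_implyP acD.
have [j _ minj] := arg_minnP (fun x => #|connect (arc D) x|) (isT : predT x0).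
exists j => i; rewrite eD => /orP[//|ji].
suff: (#|connect (arc D) i| < #|connect (arc D) j|)%N by rewrite ltnNge minj.
apply/proper_card/properP; split; last by exists j; [exact: connect0 | exact: acD].
by apply/subsetP => x; apply/connect_trans/connect1.
Qed.

End ClassesByImmoralities.

Lemma acyclic_potential (T : finType) (D : {set T * T}) (h : T -> nat) :
  (forall i j, arc D i j -> h i < h j)%N -> acyclic D.
Proof.
move=> hD; have hp x p : path (arc D) x p -> (h x <= h (last x p))%N.
  elim: p x => //= y p IH x /andP[/hD xy /IH]; exact/leq_trans/ltnW.
apply/'forall_'forall_implyP => i j /hD ij; apply/connectP => -[p /hp jp ip].
by rewrite -ip leqNgt ij in jp.
Qed.

(** * Collider sets in paths and cycles *)

(** Paths and cycles are treated at once. Their vertices are listed in order by a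
partial successor relation, nx i j meaning that j comes right after i, which is
functional and injective. Excluding cycles of length at most 3 makes the two
neighbours of a vertex distinct and nonadjacent. *)
Section SuccessorGraph.
Variables (T : finType) (nx : rel T).

Definition linked : rel T := fun i j => nx i j || nx j i.

Hypothesis nx_det : forall i j k, nx i j -> nx i k -> j = k.
Hypothesis nx_inj : forall i j k, nx i k -> nx j k -> i = j.
Hypothesis nx_asym : forall i j, nx i j -> ~~ nx j i.
Hypothesis nx_no_triangle : forall i j k, nx i j -> nx j k -> ~~ nx k i.

Definition inner j := [exists i, exists k, nx i j && nx j k].

Definition stable (S : {set T}) :=
  [forall i, forall j, nx i j ==> ~~ ((i \in S) && (j \in S))].

Definition colliders (D : {set T * T}) : {set T} :=
  [set j | inner j & [forall i, linked i j ==> arc D i j]].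

(** The edge from i to its successor is reversed exactly when i lies in S. Then
an inner vertex j receives the arc from its predecessor if that one is outside
S, and the arc from its successor if j itself is in S. *)
Definition collider_orientation (S : {set T}) : {set T * T} :=
  [set a | nx a.1 a.2 && (a.1 \notin S) || nx a.2 a.1 && (a.2 \in S)].

(** The only immorality that can be centred at an inner vertex j. *)
Definition star j : {set T} * T := ([set i | linked i j], j).

Lemma inner_star i j k : nx i j -> nx j k -> star j = ([set i; k], j).
Proof.
move=> ij jk; congr pair; apply/setP => x; rewrite !inE /linked; apply/orP/orP.
  by case=> [/nx_inj/(_ ij)->|/(nx_det jk)->]; rewrite eqxx; [left|right].
by case=> /eqP->; [left|right].
Qed.

Lemma immoralities_colliders D :
  D \in dags linked -> immoralities D = star @: colliders D.
Proof.
case/mem_dagsP=> eD asD _.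
have coll i j k : nx i j -> nx j k -> arc D i j -> arc D k j -> j \in colliders D.
  move=> nij njk ij kj; rewrite inE; apply/andP; split.
    by apply/existsP; exists i; apply/existsP; exists k; rewrite nij.
  by apply/forall_inP => x /orP[/nx_inj/(_ nij)->|/(nx_det njk)<-].
apply/setP => -[P j]; rewrite inE /=; apply/existsP/imsetP => [[i /existsP[k]]|].
  case/and5P=> /eqP-> ik _ ij kj; exists j.
    have := eD i j; have := eD k j; rewrite ij kj /= => /orP[kj'|jk] /orP[ij'|ji].
    - by rewrite (nx_inj ij' kj') eqxx in ik.
    - exact: coll kj' ji _ _.
    - exact: coll ij' jk _ _.
    - by rewrite (nx_det ji jk) eqxx in ik.
  have := eD i j; have := eD k j; rewrite ij kj /= => /orP[kj'|jk] /orP[ij'|ji].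
  - by rewrite (nx_inj ij' kj') eqxx in ik.
  - by rewrite (inner_star kj' ji) setUC.
  - by rewrite (inner_star ij' jk).
  - by rewrite (nx_det ji jk) eqxx in ik.
case=> j' + [-> ->]; rewrite inE => /andP[/existsP[i /existsP[k /andP[ij jk]]]].
move/forall_inP => allj; exists i; apply/existsP; exists k.
have [Pik] := inner_star ij jk; rewrite Pik.
rewrite eqxx !allj ?/linked ?ij ?jk ?orbT //= andbT; apply/andP; split.
  by apply: contraTneq (nx_asym ij) => ->; rewrite jk.
rewrite /skeleton -eD negb_or (nx_no_triangle ij jk) andbT.
by apply: contraTN jk => /(nx_det ij) <-; apply/negP => jj; have:= nx_asym jj; rewrite jj.
Qed.

(** As [star] is injective, passing from colliders to immoralities is injective
and keeps cardinalities. *)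
Lemma mec_poly_colliders :
  mec_poly linked = \sum_(S in colliders @: dags linked) 'X^#|S|.
Proof.
have star_inj : injective star by move=> i j [].
rewrite mec_poly_immoralities (eq_in_imset immoralities_colliders).
rewrite (imset_comp (fun S : {set T} => star @: S) colliders).
rewrite big_imset /= => [|S S' _ _ /imset_inj]; last exact.
by apply: eq_bigr => S _; rewrite card_imset.
Qed.

Lemma colliders_stable D : D \in dags linked -> stable (colliders D).
Proof.
case/mem_dagsP=> _ asD _; apply/'forall_'forall_implyP => i j ij.
apply/negP; rewrite !inE => /andP[/andP[_ /forall_inP ci] /andP[_ /forall_inP cj]].
by have := asD i j; rewrite cj ?ci ?/linked ?ij ?orbT // => /(_ isT).
Qed.

Lemma collider_orientationK (S : {set T}) :
  stable S -> {subset S <= inner} -> colliders (collider_orientation S) = S.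
Proof.
move=> /'forall_'forall_implyP stS inS; apply/setP => j; rewrite inE.
apply/andP/idP => [[/existsP[i /existsP[k /andP[_ jk]]] /forall_inP cj]|Sj].
  have: arc (collider_orientation S) k j by apply: cj; rewrite /linked jk orbT.
  by rewrite /arc inE /= (negPf (nx_asym jk)) => /andP[].
split; first exact: inS.
apply/forall_inP => i /orP[ij|ji]; rewrite /arc inE /= ?ij ?ji ?Sj ?orbT //=.
by have := stS _ _ ij; rewrite Sj andbT => ->.
Qed.

(** A topological order for the orientation: the elements of S, which are sinks,
come last, and the others are ordered by f, which has to increase along each
stretch of successors that avoids S. *)
Lemma collider_orientation_dag (S : {set T}) (f : T -> nat) :
  stable S ->
  (forall i j, nx i j -> i \notin S -> j \notin S -> f i < f j)%N ->
  collider_orientation S \in dags linked.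
Proof.
move=> /'forall_'forall_implyP stS fS; apply/mem_dagsP; split.
- move=> i j; rewrite /arc !inE /linked /=.
  by case: (nx i j); case: (nx j i); case: (i \in S); case: (j \in S).
- move=> i j; rewrite /arc !inE /=.
  have := @nx_asym i j; case: (nx i j) => [/(_ isT)/negPf->|_] /=.
    by rewrite orbF => ->.
  by rewrite orbF; case/andP=> _ ->; rewrite andbF.
pose top := (\max_x f x).+1.
apply: (@acyclic_potential _ _ (fun i => if i \in S then top else f i)) => i j.
rewrite /arc inE /= => /orP[/andP[ij iS]|/andP[ji jS]].
  rewrite (negPf iS); case: ifPn => [_|/(fS _ _ ij iS)//].
  by rewrite ltnS leq_bigmax.
have := stS _ _ ji; rewrite jS /= => /negPf->.
by rewrite ltnS leq_bigmax.
Qed.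

End SuccessorGraph.

(** * Words without two consecutive ones, Fibonacci and Lucas polynomials *)

Definition nonadj (a b : bool) := ~~ (a && b).

(** The letters b and c stand just before and just after the word t and do not
count in the exponent: the letter true forces its neighbour in t to be false,
the letter false imposes nothing. *)
Definition words_poly n (b c : bool) : {poly int} :=
  \sum_(t : n.-tuple bool | path nonadj b (rcons t c)) 'X^(count id t).

Lemma sum_tupleS n (P : pred (seq bool)) (F : seq bool -> {poly int}) :
  \sum_(t : n.+1.-tuple bool | P t) F t =
  \sum_(t : n.-tuple bool | P (false :: t)) F (false :: t) +
  \sum_(t : n.-tuple bool | P (true :: t)) F (true :: t).
Proof.
rewrite (bigID (fun t : n.+1.-tuple bool => head false t)) /= addrC; congr (_ + _).
  rewrite (reindex_onto (fun t : n.-tuple bool => [tuple of false :: t])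
             (fun t => [tuple of behead t])) /=.
    apply: eq_bigl => t; rewrite andbT.
    by rewrite (_ : (_ == t)) ?andbT //; apply/eqP/val_inj.
  by case/tupleP=> b t /andP[_ /= /negPf->]; apply: val_inj.
rewrite (reindex_onto (fun t : n.-tuple bool => [tuple of true :: t])
           (fun t => [tuple of behead t])) /=.
  apply: eq_bigl => t; rewrite andbT.
  by rewrite (_ : (_ == t)) ?andbT //; apply/eqP/val_inj.
by case/tupleP=> b t /andP[_ /= ->]; apply: val_inj.
Qed.

Lemma words_poly0 b c : words_poly 0 b c = (nonadj b c)%:R.
Proof.
rewrite /words_poly; case: (boolP (nonadj b c)) => bc.
  rewrite (big_pred1 [tuple]) ?expr0 // => t; rewrite tuple0 /= bc eqxx //.
by rewrite big_pred0 // => t; rewrite tuple0 /= (negPf bc).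
Qed.

Lemma words_polyS_true n c : words_poly n.+1 true c = words_poly n false c.
Proof.
rewrite /words_poly (sum_tupleS _ (fun t => path nonadj true (rcons t c))
                        (fun t => 'X^(count id t))) /=.
by rewrite [X in _ + X]big_pred0 ?addr0.
Qed.

Lemma words_polyS_false n c :
  words_poly n.+1 false c = words_poly n false c + 'X * words_poly n true c.
Proof.
rewrite /words_poly (sum_tupleS _ (fun t => path nonadj false (rcons t c))
                        (fun t => 'X^(count id t))) /=; congr (_ + _).
by rewrite mulr_sumr; apply: eq_bigr => t _; rewrite exprS.
Qed.

(** The cut-off in the definition of [fib_poly] is invisible here, because the
binomial coefficients vanish beyond it. *)
Lemma coef_fib_poly n k : (fib_poly n)`_k = 'C(n - k, k)%:R.
Proof.
have -> : fib_poly n = \poly_(k < n./2.+1) 'C(n - k, k)%:R.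
  by rewrite poly_def /fib_poly big_mkord.
by rewrite coef_poly; case: ltnP => // nk; rewrite bin_small //; lia.
Qed.

Lemma fib_polySS n : fib_poly n.+2 = fib_poly n.+1 + 'X * fib_poly n.
Proof.
apply/polyP => k; rewrite coefD coefXM !coef_fib_poly.
case: k => [|k] /=; first by rewrite !bin0 addr0.
rewrite -natrD; congr _%:R; rewrite !subSS.
case: (leqP k n) => kn; first by rewrite subSn // binS addnC subSS addnC.
by rewrite !bin_small //; lia.
Qed.

Lemma fib_poly0 : fib_poly 0 = 1.
Proof. by rewrite /fib_poly big_nat1 scale1r. Qed.

Lemma fib_poly1 : fib_poly 1 = 1.
Proof. by rewrite /fib_poly big_nat1 scale1r. Qed.

Lemma words_poly_fib n c : words_poly n false c = fib_poly (n + ~~ c).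
Proof.
suff : words_poly n false c = fib_poly (n + ~~ c) /\
       words_poly n.+1 false c = fib_poly (n.+1 + ~~ c) by case.
elim: n => [|n [IH0 IH1]]; last first.
  by split=> //; rewrite words_polyS_false words_polyS_true IH0 IH1 !addSn fib_polySS.
rewrite words_polyS_false !words_poly0; case: c => /=.
  by rewrite mulr0 addr0 fib_poly0 fib_poly1.
by rewrite fib_polySS fib_poly0 fib_poly1.
Qed.

(** A word read around a cycle of n + 2 letters either starts with 0, and the
other n + 1 letters are free, or with 1, and both its neighbours are 0: hence
the two terms. *)
Lemma lucas_poly_fib n : lucas_poly n.+2 = fib_poly n.+2 + 'X * fib_poly n.
Proof.
have lucasSS m : lucas_poly m.+2 = lucas_poly m.+1 + 'X * lucas_poly m by [].
suff : lucas_poly n.+2 = fib_poly n.+2 + 'X * fib_poly n /\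
       lucas_poly n.+3 = fib_poly n.+3 + 'X * fib_poly n.+1 by case.
elim: n => [|n [IH0 IH1]].
  by rewrite !lucasSS /= !fib_polySS fib_poly0 fib_poly1; split; ring.
split=> //; rewrite lucasSS IH0 IH1 (fib_polySS n.+2) (fib_polySS n); ring.
Qed.

Lemma sum_sets_tuples n (P : pred {set 'I_n}) :
  \sum_(S | P S) 'X^#|S| =
  \sum_(t : n.-tuple bool | P [set i | tnth t i]) 'X^(count id t) :> {poly int}.
Proof.
rewrite (reindex_onto (fun t : n.-tuple bool => [set i | tnth t i])
           (fun S : {set 'I_n} => [tuple i \in S | i < n])) /=; last first.
  by move=> S _; apply/setP => i; rewrite inE tnth_mktuple.
apply: eq_big => [t|t _].
  rewrite (_ : (_ == t)) ?andbT //; apply/eqP/eq_from_tnth => i.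
  by rewrite tnth_mktuple inE.
congr ('X^_); rewrite cardsE cardE -sum1_size big_filter /=.
rewrite -sum1_count big_tuple; exact: eq_bigl.
Qed.

(** * Paths *)

Definition path_next p : rel 'I_p := fun i j => i.+1 == j :> nat.

(** Excluding the two ends of the path from S amounts to adding a letter true
at each end of the word of S. *)
Lemma path_words p (t : p.+1.-tuple bool) (S := [set i | tnth t i]) :
  stable (@path_next p.+1) S && (S \subset inner (@path_next p.+1))
  = path nonadj true (rcons t true).
Proof.
have nthS (i : 'I_p.+1) : (i \in S) = nth false t i by rewrite inE (tnth_nth false).
have nthr i : (i < p.+1)%N -> nth false (rcons t true) i = nth false t i.
  by move=> ip; rewrite nth_rcons size_tuple ip.
have nthl : nth false (rcons t true) p.+1 = true.
  by rewrite nth_rcons size_tuple ltnn eqxx.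
apply/andP/(pathP false); rewrite size_rcons size_tuple.
  move=> [/'forall_'forall_implyP stS /subsetP inS] [_|i ip] /=.
    rewrite nthr // -(nthS ord0); apply/negP => /inS/existsP[i /existsP[k]].
    by case/andP.
  rewrite nthr //.
  case: (ltnP i p) => [lip|gip].
    rewrite nthr // -(nthS (@Ordinal p.+1 i ip)) -(nthS (@Ordinal p.+1 i.+1 lip)).
    by rewrite /nonadj; apply: stS; rewrite /path_next.
  have -> : i = p by apply/eqP; rewrite eqn_leq gip andbT -ltnS.
  rewrite nthl -(nthS ord_max) /nonadj andbT; apply/negP => /inS/existsP[j /existsP[k]].
  by case/andP=> _ /eqP /= kp; have := ltn_ord k; rewrite -kp ltnn.
move=> ok; split.
  apply/'forall_'forall_implyP => i j /eqP ij; rewrite !nthS -ij.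
  have ip : (i.+1 < p.+1)%N by rewrite ij.
  by have /= := ok i.+1 (ltnW ip); rewrite (nthr _ (ltnW ip)) (nthr _ ip).
apply/subsetP => i; rewrite nthS => ti.
have i_gt0 : (0 < i)%N.
  by rewrite lt0n; apply: contraTneq ti => ->; have /= := ok 0%N isT; rewrite nthr.
have i_ltp : (i.+1 < p.+1)%N.
  rewrite ltn_neqAle ltn_ord andbT; apply: contraTneq ti => -[ip].
  by have /= := ok p.+1 (ltnSn _); rewrite nthl ip nthr // /nonadj andbT.
apply/existsP; exists (inord i.-1); apply/existsP; exists (inord i.+1).
rewrite /path_next !inordK ?prednK // ?eqxx //; exact: leq_trans (ltn_ord i).
Qed.

Lemma mec_poly_path p : mec_poly (@path_graph p.+1) = fib_poly p.
Proof.
rewrite -[@path_graph _]/(linked (@path_next p.+1)).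
have det i j k : @path_next p.+1 i j -> path_next i k -> j = k.
  by move=> /eqP ij /eqP ik; apply/val_inj; rewrite /= -ij -ik.
have inj i j k : @path_next p.+1 i k -> path_next j k -> i = j.
  by rewrite /path_next => /eqP ik /eqP jk; apply/val_inj/succn_inj; rewrite /= ik.
have asym i j : @path_next p.+1 i j -> ~~ path_next j i.
  by rewrite /path_next; lia.
have tri i j k : @path_next p.+1 i j -> path_next j k -> ~~ path_next k i.
  by rewrite /path_next; lia.
rewrite mec_poly_colliders //.
transitivity (words_poly p.+1 true true); last first.
  by rewrite words_polyS_true words_poly_fib addn0.
rewrite /words_poly -(eq_bigl _ _ (@path_words p)).
rewrite -(sum_sets_tuples (fun S => stable _ S && (S \subset inner _))).
apply: eq_bigl => S; apply/imsetP/andP => [[D De ->]|[stS /subsetP inS]].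
  split; first exact: colliders_stable.
  by apply/subsetP => j; rewrite inE => /andP[].
exists (collider_orientation (@path_next p.+1) S); last by rewrite collider_orientationK.
by apply: (@collider_orientation_dag _ _ asym _ val) => // i j /eqP ij _ _; rewrite /= -ij.
Qed.

(** * Cycles *)

Definition cycle_next p : rel 'I_p := fun i j => ordS i == j.

Lemma ordS_val p (i : 'I_p) : ordS i = (if i.+1 == p then 0 else i.+1)%N :> nat.
Proof.
rewrite /=; case: eqP => [->|ip]; first by rewrite modnn.
by rewrite modn_small // ltn_neqAle ltn_ord andbT; apply/eqP.
Qed.

Lemma cycle_nextE p (i j : 'I_p) :
  cycle_next i j = ((if i.+1 == p then 0 else i.+1)%N == j :> nat).
Proof. by rewrite -ordS_val. Qed.

Lemma cycle_words p (t : p.+1.-tuple bool) :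
  stable (@cycle_next p.+1) [set i | tnth t i] = cycle nonadj t.
Proof.
case/tupleP: t => b t; set S := [set _ | _].
have nthS (i : 'I_p.+1) : (i \in S) = nth false (b :: t) i.
  by rewrite inE (tnth_nth false).
have nthr (i : 'I_p.+1) : nth false (rcons t b) i = nth false (b :: t) (ordS i).
  rewrite ordS_val nth_rcons size_tuple eqSS; case: ltngtP => //.
  by have := ltn_ord i; lia.
have nthl (i : 'I_p.+1) : nth false (b :: rcons t b) i = nth false (b :: t) i.
  by rewrite -rcons_cons nth_rcons /= size_tuple ltn_ord.
apply/'forall_'forall_implyP/(pathP false); rewrite size_rcons size_tuple.
  move=> stS i ip; pose i' := @Ordinal p.+1 i ip.
  rewrite (nthr i') (nthl i') -(nthS i') -nthS.
  by rewrite /nonadj; apply: stS; rewrite /cycle_next.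
by move=> ok i _ /eqP<-; rewrite !nthS -nthl -nthr; apply: ok.
Qed.

Lemma mec_poly_cycle p : (4 <= p)%N -> mec_poly (@cycle_graph p) = lucas_poly p - 1.
Proof.
case: p => [|[|p]] // p_gt3.
rewrite -[@cycle_graph _]/(linked (@cycle_next p.+2)).
have det i j k : @cycle_next p.+2 i j -> cycle_next i k -> j = k.
  by move=> /eqP<- /eqP<-.
have inj i j k : @cycle_next p.+2 i k -> cycle_next j k -> i = j.
  by move=> /eqP<- /eqP/ordS_inj.
have asym i j : @cycle_next p.+2 i j -> ~~ cycle_next j i.
  rewrite !cycle_nextE.
  by have := ltn_ord i; case: (i.+1 =P _); case: (j.+1 =P _); lia.
have tri i j k : @cycle_next p.+2 i j -> cycle_next j k -> ~~ cycle_next k i.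
  rewrite !cycle_nextE.
  by have := ltn_ord i; case: (i.+1 =P _); case: (j.+1 =P _); case: (k.+1 =P _); lia.
rewrite mec_poly_colliders //.
have <- : \sum_(S | stable (@cycle_next p.+2) S) 'X^#|S| = lucas_poly p.+2.
  rewrite lucas_poly_fib sum_sets_tuples (eq_bigl _ _ (@cycle_words p.+1)).
  rewrite (sum_tupleS _ (fun t => cycle nonadj t) (fun t => 'X^(count id t))) /=.
  congr (_ + _).
    by rewrite -[LHS]/(words_poly p.+1 false false) words_poly_fib addn1.
  under eq_bigr do rewrite exprS; rewrite -mulr_sumr; congr (_ * _).
  rewrite -[LHS]/(words_poly p.+1 true true) words_polyS_true words_poly_fib.
  by rewrite addn0.
(* The empty set is the stable set that no acyclic orientation realizes. *)
rewrite [in RHS](bigD1 set0) /=; last first.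
  by apply/'forall_'forall_implyP => i j _; rewrite inE.
rewrite cards0 expr0 addrAC subrr add0r.
apply: eq_bigl => S; apply/imsetP/andP => [[D De ->]|[stS /set0Pn[s Ss]]].
  split; first exact: colliders_stable.
  have [j jD] := dag_sink ord0 De; apply/set0Pn; exists j; rewrite inE.
  apply/andP; split; last exact/forall_inP.
  apply/existsP; exists (ord_pred j); apply/existsP; exists (ordS j).
  by rewrite /cycle_next ord_predK !eqxx.
exists (collider_orientation (@cycle_next p.+2) S); last first.
  rewrite collider_orientationK // => j _.
  apply/existsP; exists (ord_pred j); apply/existsP; exists (ordS j).
  by rewrite /cycle_next ord_predK !eqxx.
(* The potential goes once around the cycle, starting at the element s of S;
   so it can only drop at the step that enters s. *)
apply: (@collider_orientation_dag _ _ asym _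
          (fun i => if (s <= i)%N then val i else i + p.+2)%N) => // i j ij iS jS.
have js : j != s by apply: contraNneq jS => ->.
move: ij js; rewrite -val_eqE cycle_nextE /=.
have := ltn_ord s; case: (i.+1 =P _); case: (leqP s i); case: (leqP s j); lia.
Qed.

(** * Values at 1 and degrees *)

Lemma horner1_fib_poly n : (fib_poly n).[1] = (fib n)%:R.
Proof.
suff : (fib_poly n).[1] = (fib n)%:R /\ (fib_poly n.+1).[1] = (fib n.+1)%:R by case.
elim: n => [|n [IH0 IH1]]; first by rewrite fib_poly0 fib_poly1 hornerC.
split=> //; rewrite fib_polySS hornerD hornerM hornerX mul1r IH0 IH1 -natrD.
by [].
Qed.

Lemma horner1_lucas_poly n : (lucas_poly n).[1] = (lucas n)%:R.
Proof.
suff : (lucas_poly n).[1] = (lucas n)%:R /\ (lucas_poly n.+1).[1] = (lucas n.+1)%:R by case.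
elim: n => [|n [IH0 IH1]]; first by rewrite /= !hornerE.
split=> //; rewrite -[lucas_poly n.+2]/(lucas_poly n.+1 + 'X * lucas_poly n).
by rewrite hornerD hornerM hornerX mul1r IH0 IH1 -natrD.
Qed.

Lemma lucas_gt0 n : (0 < lucas n)%N.
Proof.
suff : (0 < lucas n)%N /\ (0 < lucas n.+1)%N by case.
by elim: n => [|n [IH0 IH1]] //; split=> //; rewrite /= ltn_addr.
Qed.

Lemma size_poly_top (p : {poly int}) n :
  p`_n != 0 -> (forall k, (n < k)%N -> p`_k = 0) -> size p = n.+1.
Proof.
move=> pn top; apply/eqP; rewrite eqn_leq; apply/andP; split; first exact/leq_sizeP.
by rewrite ltnNge; apply: contraNN pn => /(nth_default 0)->.
Qed.

Lemma size_fib_poly n : size (fib_poly n) = n./2.+1.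
Proof.
apply: size_poly_top => [|k nk]; rewrite coef_fib_poly.
  by rewrite pnatr_eq0 -lt0n bin_gt0; lia.
by rewrite bin_small //; lia.
Qed.

Lemma size_lucas_poly n : (2 <= n)%N -> size (lucas_poly n - 1) = n./2.+1.
Proof.
case: n => [|[|n]] // _; rewrite lucas_poly_fib.
have coefE k : (fib_poly n.+2 + 'X * fib_poly n - 1)`_k.+1 =
               ('C(n.+2 - k.+1, k.+1) + 'C(n - k, k))%:R.
  by rewrite coefB coefD coefXM !coef_fib_poly coef1 subr0 natrD.
rewrite (_ : n.+2./2 = n./2.+1) //.
apply: size_poly_top => [|[|k] //]; rewrite coefE.
  by rewrite pnatr_eq0 -lt0n addn_gt0 !bin_gt0; apply/orP; left; lia.
by move=> nk; rewrite !bin_small //; lia.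
Qed.

Theorem theorem2p1 :
  (forall p : nat, (1 <= p)%N ->
     mec_poly (@path_graph p) = fib_poly (p - 1)) /\
  (forall p : nat, (4 <= p)%N ->
     mec_poly (@cycle_graph p) = lucas_poly p - 1) /\
  (forall p : nat, (1 <= p)%N ->
     num_mecs (@path_graph p) = fib (p - 1)) /\
  (forall p : nat, (4 <= p)%N ->
     num_mecs (@cycle_graph p) = (lucas p - 1)%N) /\
  (forall p : nat,
     max_immoralities (@path_graph p.+1) = p./2) /\
  (forall p : nat, (4 <= p)%N ->
     max_immoralities (@cycle_graph p) = p./2).
Proof.
have pathE p : (1 <= p)%N -> mec_poly (@path_graph p) = fib_poly (p - 1).
  by case: p => // p _; rewrite mec_poly_path subn1.
do 2!split=> //; first exact: mec_poly_cycle.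
have natr_int_inj m n : m%:R = n%:R :> int -> m = n by move/eqP; rewrite eqr_nat => /eqP.
split=> [p p_gt0|]; last split=> [p p_gt3|]; last split=> [p|p p_gt3].
- by apply: natr_int_inj; rewrite -horner1_mec_poly pathE // horner1_fib_poly.
- apply: natr_int_inj; rewrite -horner1_mec_poly mec_poly_cycle //.
  by rewrite hornerD hornerN hornerC horner1_lucas_poly natrB ?lucas_gt0.
- by rewrite -deg_mec_poly mec_poly_path size_fib_poly.
- by rewrite -deg_mec_poly mec_poly_cycle // size_lucas_poly // (leq_trans _ p_gt3).
Qed.
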